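(* Let $F:\mathbb{R}^d\to\mathbb{R}^d$ be $m$-strongly monotone and $L$-Lipschitz with $m,L>0$, and let $z^*\in\mathbb{R}^d$ satisfy $F(z^* )=0$. Let $\eta>0$ be arbitrary and let $(z_k)_{k\ge 0}$ be generated by the proximal point method $$z_{k+1}=z_k-\eta F(z_{k+1}),\qquad k\ge 0 .$$ Then the method converges linearly, with $$\|z_k-z^*\|_2^2\le\left(\frac{1}{1+2\eta m}\right)^k\|z_0-z^*\|_2^2\qquad\text{for all }k\ge 0 .$$
   Context: $F$ is $m$-strongly monotone if $(F(z_1)-F(z_2))^\top(z_1-z_2)\ge m\|z_1-z_2\|_2^2$ for all $z_1,z_2\in\mathbb{R}^d$, and $L$-Lipschitz if $\|F(z_1)-F(z_2)\|_2\le L\|z_1-z_2\|_2$ for all $z_1,z_2\in\mathbb{R}^d$. *)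

(* Defs.v *)
From mathcomp Require Import all_boot all_order all_algebra.
From mathcomp Require Import reals.

Set Implicit Arguments.
Unset Strict Implicit.
Unset Printing Implicit Defensive.

Import Order.TTheory GRing.Theory Num.Theory.
Local Open Scope ring_scope.

Definition dotv (R : realType) (d : nat) (u v : 'cV[R]_d) : R :=
  (u^T *m v) 0 0.

(* Not the library's norm on matrices, which is the sup norm. *)
Definition norm2 (R : realType) (d : nat) (u : 'cV[R]_d) : R :=
  Num.sqrt (\sum_(i < d) u i 0 ^+ 2).

Definition strongly_monotone (R : realType) (d : nat) (m : R)
    (F : 'cV[R]_d -> 'cV[R]_d) : Prop :=
  forall z1 z2 : 'cV[R]_d,
    m * norm2 (z1 - z2) ^+ 2 <= dotv (F z1 - F z2) (z1 - z2).

Definition lipschitz2 (R : realType) (d : nat) (L : R)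
    (F : 'cV[R]_d -> 'cV[R]_d) : Prop :=
  forall z1 z2 : 'cV[R]_d, norm2 (F z1 - F z2) <= L * norm2 (z1 - z2).

(* The step is implicit in z k.+1, so this is a relation on sequences rather
   than a recursive definition. *)
Definition proximal_point (R : realType) (d : nat) (eta : R)
    (F : 'cV[R]_d -> 'cV[R]_d) (z : nat -> 'cV[R]_d) : Prop :=
  forall k : nat, z k.+1 = z k - eta *: F (z k.+1).

(* Main.v *)
Require Import Defs.
From mathcomp Require Import all_boot all_order all_algebra.
From mathcomp Require Import reals.
From mathcomp Require Import ring lra.

Set Implicit Arguments.
Unset Strict Implicit.
Unset Printing Implicit Defensive.

Import Order.TTheory GRing.Theory Num.Theory.
Local Open Scope ring_scope.

(** The step is implicit, so it is read backwards: with [a] the new error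
    [z k.+1 - zs] and [b = F (z k.+1)], the old error is [a + eta *: b].
    Expanding its squared norm gives [|a|^2 + 2 eta <b, a> + eta^2 |b|^2].
    Strong monotonicity between [z k.+1] and the zero [zs] bounds the cross
    term below by [2 eta m |a|^2], and the last term is nonnegative, so the old
    squared error is at least [1 + 2 eta m] times the new one
    ([proximal_step_contraction]).  Because that last term, the only one
    quadratic in [eta], has the favourable sign, [eta] may be arbitrarily large.
    Induction on [k] then gives the geometric rate. *)

Lemma sqr_norm2 (R : realType) (d : nat) (u : 'cV[R]_d) :
  norm2 u ^+ 2 = \sum_(i < d) u i 0 ^+ 2.
Proof. by rewrite /norm2 sqr_sqrtr // sumr_ge0 // => i _; exact: sqr_ge0. Qed.

Lemma sqr_norm2_addZ (R : realType) (d : nat) (t : R) (u v : 'cV[R]_d) :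
  norm2 (u + t *: v) ^+ 2 =
    norm2 u ^+ 2 + 2 * t * dotv v u + t ^+ 2 * norm2 v ^+ 2.
Proof.
rewrite !sqr_norm2 /dotv mxE !mulr_sumr -!big_split /=.
by apply: eq_bigr => i _; rewrite !mxE; ring.
Qed.

(** This bounds the resolvent of [F], which maps [x] to [y]; the graph of the
    resolvent is used in place of a function because the equation defining [y]
    is implicit. *)
Lemma proximal_step_contraction (R : realType) (d : nat)
    (F : 'cV[R]_d -> 'cV[R]_d) (m t : R) (x y zs : 'cV[R]_d) :
  strongly_monotone m F -> F zs = 0 -> 0 <= t -> y = x - t *: F y ->
  (1 + 2 * t * m) * norm2 (y - zs) ^+ 2 <= norm2 (x - zs) ^+ 2.
Proof.
move=> F_mono F_zs t_ge0 y_prox.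
have -> : x - zs = (y - zs) + t *: F y.
  by rewrite addrAC {1}y_prox subrK.
have mono := F_mono y zs; rewrite F_zs subr0 in mono.
have cross := ler_wpM2l t_ge0 mono.
have quad : 0 <= t ^+ 2 * norm2 (F y) ^+ 2 by rewrite mulr_ge0 ?sqr_ge0.
by rewrite sqr_norm2_addZ; lra.
Qed.

Theorem theorem3 (R : realType) (d : nat) (F : 'cV[R]_d -> 'cV[R]_d)
    (m L : R) (m_gt0 : 0 < m) (L_gt0 : 0 < L)
    (F_mono : strongly_monotone m F) (F_lip : lipschitz2 L F)
    (zs : 'cV[R]_d) (F_zs : F zs = 0)
    (eta : R) (eta_gt0 : 0 < eta)
    (z : nat -> 'cV[R]_d) (z_prox : proximal_point eta F z) :
  0 < 1 / (1 + 2 * eta * m) < 1 /\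
  forall k : nat,
    norm2 (z k - zs) ^+ 2 <=
      (1 / (1 + 2 * eta * m)) ^+ k * norm2 (z 0%N - zs) ^+ 2.
Proof.
set c := 1 + 2 * eta * m.
have c_gt1 : 1 < c by rewrite ltrDl !mulr_gt0.
have c_gt0 : 0 < c by exact: lt_trans c_gt1.
split; first by rewrite divr_gt0 //= ltr_pdivrMr // mul1r.
elim=> [|k IHk]; first by rewrite expr0 mul1r.
rewrite [_ ^+ k.+1]exprS -mulrA.
have /le_trans : norm2 (z k.+1 - zs) ^+ 2 <=
    1 / c * norm2 (z k - zs) ^+ 2.
  rewrite mulrAC mul1r ler_pdivlMr // mulrC.
  exact: proximal_step_contraction (ltW eta_gt0) (z_prox k).
by apply; rewrite ler_wpM2l // divr_ge0 // ltW.
Qed.
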